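(* Define the following $K_w+2$ rate-memory pairs $(R_t, M_t)$, $t=0,1,\ldots,K_w+1$: (i) $R_0 := F\left(\frac{K_w}{1-\delta_w}+\frac{K_s}{1-\delta_s}\right)^{-1}$, $M_0 := 0$; (ii) for each $t\in\{1,\ldots,K_w\}$: $$R_t := \frac{F(1-\delta_w)\left(1+\frac{K_w-t+1}{tK_s}\cdot\frac{\delta_w-\delta_s}{1-\delta_w}\right)}{\frac{K_w-t+1}{t}\left(1+\frac{K_w-t}{(t+1)K_s}\cdot\frac{\delta_w-\delta_s}{1-\delta_w}\right)+K_s\frac{1-\delta_w}{1-\delta_s}},$$ $$M_t := R_t\,\frac{D}{K_w}\left(t-\left(1+\frac{K_w-t+1}{tK_s}\cdot\frac{\delta_w-\delta_s}{1-\delta_w}\right)^{-1}\right);$$ (iii) $R_{K_w+1} := F\frac{1-\delta_s}{K_s}$, $M_{K_w+1} := DF\frac{1-\delta_s}{K_s}$. Then the capacity-memory tradeoff satisfies $$C(M)\ \geq\ \text{upper convex hull}\big\{(R_t,M_t)\colon t=0,1,\ldots,K_w+1\big\}.$$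
   Context: Consider a memoryless packet-erasure broadcast channel with input alphabet $\{0,1\}^F$ (packets of $F$ bits) and output alphabet $\{0,1\}^F\cup\{\Delta\}$ at each of $K=K_w+K_s$ receivers, where receiver $k$ receives the input packet with probability $1-\delta_k$ and the erasure symbol $\Delta$ with probability $\delta_k$. There are $K_w$ weak receivers, each with erasure probability $\delta_w$ and each equipped with a cache memory of $nM$ bits, and $K_s$ strong receivers, each with erasure probability $\delta_s$, $0<\delta_s\le\delta_w\le 1$, and no cache memory. A transmitter has a library of $D\ge K$ independent messages $W_1,\ldots,W_D$, each uniformly distributed over $\{1,\ldots,\lfloor 2^{nR}\rfloor\}$. In an error-free caching phase, before the demands are known, each weak receiver $i$ stores $V_i=g_i(W_1,\ldots,W_D)\in\{1,\ldots,\lfloor 2^{nM}\rfloor\}$. In the delivery phase, each receiver $k$ demands one message $W_{d_k}$, where the demand vector $(d_1,\ldots,d_K)$ can be any element of $\{1,\ldots,D\}^K$ and is known to the transmitter and all receivers; the transmitter sends a length-$n$ codeword depending on the demand vector and the library, weak receivers decode from their channel outputs and cache contents, strong receivers from their channel outputs only. A pair $(R,M)$ is achievable if the worst-case (over all demand vectors) probability that some receiver decodes its demanded message incorrectly can be made arbitrarily small for sufficiently large $n$. The capacity-memory tradeoff $C(M)$ is the supremum of all rates $R$ such that $(R,M)$ is achievable.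
   Formalization: The weak erasure probability is taken strictly below 1 (at δ_w = 1 the formulas for R_t and M_t divide by zero), and there is assumed to be at least one weak and at least one strong receiver. *)

(* Defs.v *)
From HB Require Import structures.
From mathcomp Require Import all_boot all_order all_algebra.
From mathcomp Require Import all_classical all_reals.
From mathcomp Require Import ereal exp.
Set Implicit Arguments. Unset Strict Implicit. Unset Printing Implicit Defensive.
Import Order.TTheory GRing.Theory Num.Theory.
Local Open Scope ring_scope.
Local Open Scope classical_set_scope.

Section PacketErasureCaching.
Variable R : realType.

(* A packet of F bits; a channel output is [Some p] (received) or [None] (erasure Delta). *)
Definition packet (F : nat) := {ffun 'I_F -> bool}.
Definition chan_out (F : nat) := option (packet F).

Definition nvals (n : nat) (r : R) : nat := Num.truncn (2 `^ (n%:R * r)).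

(* library of D messages, each in {0,..,L-1} (i.e. {1,..,L} shifted) *)
Definition library (D L : nat) := {ffun 'I_D -> 'I_L}.
(* demand vectors: receivers 'I_(Kw+Ks); weak receivers are lshift Ks i (i : 'I_Kw),
   strong receivers are rshift Kw j (j : 'I_Ks) *)
Definition demand (Kw Ks D : nat) := {ffun 'I_(Kw + Ks) -> 'I_D}.

Record scheme (F Kw Ks D n L Lc : nat) := Scheme {
  cache : 'I_Kw -> library D L -> 'I_Lc;
  enc : demand Kw Ks D -> library D L -> {ffun 'I_n -> packet F};
  dec_w : demand Kw Ks D -> 'I_Kw -> {ffun 'I_n -> chan_out F} -> 'I_Lc -> 'I_L;
  dec_s : demand Kw Ks D -> 'I_Ks -> {ffun 'I_n -> chan_out F} -> 'I_L
}.

Definition delta (Kw Ks : nat) (dw ds : R) (k : 'I_(Kw + Ks)) : R :=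
  if (k < Kw)%N then dw else ds.

(* erasure patterns: e k t = true iff receiver k receives Delta at time t.
   Erasures are independent over time and across receivers (memoryless). *)
Definition epattern (Kw Ks n : nat) := {ffun 'I_(Kw + Ks) -> {ffun 'I_n -> bool}}.

Definition pattern_prob (Kw Ks n : nat) (dw ds : R) (e : epattern Kw Ks n) : R :=
  \prod_(k : 'I_(Kw + Ks)) \prod_(t : 'I_n)
     (if e k t then delta dw ds k else 1 - delta dw ds k).

Definition channel_output F n (x : {ffun 'I_n -> packet F}) (et : {ffun 'I_n -> bool})
  : {ffun 'I_n -> chan_out F} := [ffun t => if et t then None else Some (x t)].

Definition some_error F Kw Ks D n L Lc (C : scheme F Kw Ks D n L Lc)
  (d : demand Kw Ks D) (W : library D L) (e : epattern Kw Ks n) : bool :=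
  let x := enc C d W in
  [exists i : 'I_Kw,
     dec_w C d i (channel_output x (e (lshift Ks i))) (cache C i W) != W (d (lshift Ks i))]
  || [exists j : 'I_Ks,
     dec_s C d j (channel_output x (e (rshift Kw j))) != W (d (rshift Kw j))].

Definition error_prob F Kw Ks D n L Lc (dw ds : R) (C : scheme F Kw Ks D n L Lc)
  (d : demand Kw Ks D) : R :=
  \sum_(W : library D L) \sum_(e : epattern Kw Ks n)
    (#|{: library D L}|%:R)^-1 * pattern_prob dw ds e * (some_error C d W e)%:R.

Definition achievable (F Kw Ks D : nat) (dw ds : R) (r m : R) : Prop :=
  0 <= r /\ 0 <= m /\
  forall eps : R, 0 < eps -> exists N : nat, forall n : nat, (N <= n)%N ->
    exists C : scheme F Kw Ks D n (nvals n r) (nvals n m),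
      forall d : demand Kw Ks D, error_prob dw ds C d <= eps.

Definition capacity_memory (F Kw Ks D : nat) (dw ds : R) (m : R) : \bar R :=
  ereal_sup [set r%:E | r in [set r | achievable F Kw Ks D dw ds r m]].

Definition rho (Kw Ks : nat) (dw ds : R) (t : nat) : R :=
  1 + (Kw%:R - t%:R + 1) / (t%:R * Ks%:R) * ((dw - ds) / (1 - dw)).

Definition Rpt (F Kw Ks : nat) (dw ds : R) (t : nat) : R :=
  if t == 0%N then F%:R * (Kw%:R / (1 - dw) + Ks%:R / (1 - ds))^-1
  else if (t <= Kw)%N then
    F%:R * (1 - dw) * rho Kw Ks dw ds t /
    ((Kw%:R - t%:R + 1) / t%:R *
       (1 + (Kw%:R - t%:R) / ((t%:R + 1) * Ks%:R) * ((dw - ds) / (1 - dw)))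
     + Ks%:R * ((1 - dw) / (1 - ds)))
  else F%:R * (1 - ds) / Ks%:R.

Definition Mpt (F Kw Ks D : nat) (dw ds : R) (t : nat) : R :=
  if t == 0%N then 0
  else if (t <= Kw)%N then
    Rpt F Kw Ks dw ds t * (D%:R / Kw%:R) * (t%:R - (rho Kw Ks dw ds t)^-1)
  else D%:R * F%:R * (1 - ds) / Ks%:R.

End PacketErasureCaching.

(* Main.v *)
(** Every library message is split into pieces indexed by a set T of weak
receivers and a flag; weak receiver i caches the pieces with i in T.  The
delivery is cut into one phase per set S of weak receivers.  For nonempty S,
the phase carries the XOR over k in S of the pieces of message d_k with index
S \ {k}, on top of which the flagged pieces with index S requested by the
strong receivers are piggybacked: the weak receivers in S have these in their
caches, so only the strong receivers pay for them.  Phase 0 carries the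
unflagged pieces of the strong receivers.

Each phase uses a random codebook.  A receiver fails only if some other phase
message compatible with its side information agrees with the sent codeword on
all non-erased symbols.  Given the erasures this has probability at most
min(1, s 2^(-F m)), with s candidates and m non-erased symbols, hence at most
(s 2^(-F m))^th for th in [0,1]; for small th the expectation over the erasures
decays exponentially as soon as log2 s / n_S < F (1 - delta), where n_S is the
length of the phase.

The rate constraints are linear in the piece sizes, so that the convex hull
follows from exhibiting piece sizes for each corner point. *)

Require Import Defs.
From HB Require Import structures.
From mathcomp Require Import all_boot all_order all_algebra perm.
From mathcomp Require Import all_classical all_reals.
From mathcomp Require Import ereal sequences exp.
From mathcomp Require Import ring lra.
Set Implicit Arguments. Unset Strict Implicit. Unset Printing Implicit Defensive.
Import Order.TTheory GRing.Theory Num.Theory.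
Local Open Scope ring_scope.

(** * Random coding over erasure channels *)

Lemma card_packet F : #|{: packet F}| = (2 ^ F)%N.
Proof. by rewrite card_ffun card_bool card_ord. Qed.

(** Overwriting the value at [a'] of a colliding function loses nothing: the old value can still be
    read off at [a]. *)
Lemma card_ffun_collision (A B : finType) (a a' : A) : a' != a ->
  (#|[set h : {ffun A -> B} | h a' == h a]| * #|B| <= #|{: {ffun A -> B}}|)%N.
Proof.
move=> aa'.
pose g (hv : {ffun A -> B} * B) : {ffun A -> B} :=
  [ffun x => if x == a' then hv.2 else hv.1 x].
rewrite -cardsT -cardsX -(@card_in_imset _ _ g) ?max_card //.
move=> [h v] [h' v'] /=; rewrite !inE /= !andbT => /eqP ha /eqP h'a /ffunP e.
have ev : v = v' by have := e a'; rewrite !ffunE eqxx.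
congr pair => //; apply/ffunP => x.
have [->|xa] := eqVneq x a'; last by have := e x; rewrite !ffunE (negPf xa).
by rewrite ha h'a; have := e a; rewrite !ffunE eq_sym (negPf aa').
Qed.

(** The entries of a codebook at different channel uses are independent, so the count factors over
    [t]; each use in [T] costs a factor [#|B|]. *)
Lemma card_codebook_collision (A B : finType) n (T : pred 'I_n) (a a' : A) :
  a' != a ->
  (#|[set c : {ffun 'I_n -> {ffun A -> B}} | [forall (t | T t), c t a' == c t a]]|
    * #|B| ^ #|T| <= #|{: {ffun 'I_n -> {ffun A -> B}}}|)%N.
Proof.
move=> aa'.
pose w (t : 'I_n) (h : {ffun A -> B}) : nat := (T t ==> (h a' == h a)).
have -> : #|[set c : {ffun 'I_n -> {ffun A -> B}} | [forall (t | T t), c t a' == c t a]]|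
    = (\prod_t \sum_h w t h)%N.
  rewrite bigA_distr_bigA /= cardsE -sum1_card big_mkcond /=.
  apply: eq_bigr => c _; rewrite unfold_in /=.
  case: ifP => [/forallP H|/negbT/forallPn[t Ht]].
    by rewrite big1 // => t _; rewrite /w H.
  by rewrite (bigD1 t) //= /w (negPf Ht) mul0n.
rewrite -prod_nat_const [X in (_ * X)%N]big_mkcond -big_split /= card_ffun card_ord.
rewrite -[X in (_ ^ X)%N]card_ord -prod_nat_const.
apply: leq_prod => t _; rewrite /w.
case: (boolP (T t)) => [Tt|Tt].
  rewrite unfold_in Tt; apply: leq_trans (card_ffun_collision B aa').
  rewrite leq_mul2r; apply/orP; right.
  by rewrite cardsE -sum1_card [X in (_ <= X)%N]big_mkcond leq_sum //= => h _; case: (h a' == h a).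
rewrite unfold_in (negPf Tt) muln1 (eq_bigr (fun=> 1%N)) //.
by rewrite sum1_card.
Qed.

Section UnionBound.
Variable R : realType.

(* Gallager's device: min(1, x) <= x ^ th for th in [0,1], here with x = expR y. *)
Lemma min1_expR_le (z y th : R) : 0 <= th <= 1 -> z <= 1 -> z <= expR y ->
  z <= expR (th * y).
Proof.
move=> /andP[t0 t1] z1 zy; have [y0|y0] := leP 0 y.
  by apply: le_trans z1 _; rewrite -expR0 ler_expR mulr_ge0.
by apply: le_trans zy _; rewrite ler_expR; nra.
Qed.

(** By independence the expectation factors over receivers and channel uses, and every factor except
    those of receiver [k] at uses in [T] is a total probability, hence 1. *)
Lemma sum_prod_erasure (K : finType) n (del : K -> R) (k : K) (T : pred 'I_n) (z : R) :
  \sum_(e : {ffun K -> {ffun 'I_n -> bool}})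
     (\prod_k' \prod_t (if e k' t then del k' else 1 - del k')) *
     (\prod_(t | T t) (if e k t then 1 else z))
  = (del k + (1 - del k) * z) ^+ #|T|.
Proof.
pose G k' (f : {ffun 'I_n -> bool}) : R :=
  \prod_t ((if f t then del k' else 1 - del k') *
           (if (k' == k) && T t then (if f t then 1 else z) else 1)).
transitivity (\sum_(e : {ffun K -> {ffun 'I_n -> bool}}) \prod_k' G k' (e k')).
  apply: eq_bigr => e _; rewrite /G.
  under [RHS]eq_bigr do rewrite big_split /=.
  rewrite big_split /=; congr (_ * _).
  rewrite (bigD1 k) //= eqxx /= [X in _ * X]big1 ?mulr1 ?big_mkcond //.
  by move=> k' /negPf k'k; apply: big1 => t _; rewrite k'k.
rewrite -bigA_distr_bigA /= (bigD1 k) //= [X in _ * X]big1 ?mulr1.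
  pose g (t : 'I_n) (b : bool) : R := (if b then del k else 1 - del k) *
           (if T t then (if b then 1 else z) else 1).
  transitivity (\prod_t \sum_b g t b).
    by rewrite bigA_distr_bigA /=; apply: eq_bigr => f _; apply: eq_bigr => t _; rewrite eqxx.
  rewrite -prodr_const [RHS]big_mkcond; apply: eq_bigr => t _.
  rewrite big_bool /g /= unfold_in; case: (T t); ring.
move=> k' /negPf k'k; pose g (b : bool) : R := (if b then del k' else 1 - del k').
transitivity (\prod_(t < n) \sum_b g b).
  rewrite bigA_distr_bigA /=; apply: eq_bigr => f _; apply: eq_bigr => t _.
  by rewrite k'k /= mulr1.
by apply: big1 => t _; rewrite big_bool /g /=; ring.
Qed.

End UnionBound.

Section RandomCoding.
Variables (R : realType) (F n : nat) (K P A Lib : finType) (X : eqType).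
Variables (del : K -> R) (phi : 'I_n -> P) (msg : Lib -> P -> A).
Variables (side : K -> Lib -> nat) (rel : K -> pred P) (want : K -> Lib -> X).
Variables (s : K -> P -> nat) (th : R).

Let book := {ffun 'I_n -> {ffun A -> packet F}}.
Let pattern := {ffun K -> {ffun 'I_n -> bool}}.
Let z : R := expR (- (th * (F%:R * ln 2))).

(** [phi t] is the phase of channel use [t], [msg W p] the message encoded in phase [p], [side k W]
    what receiver [k] knows beforehand, and [rel k] the set of phases that it uses. *)
Definition codeword (c : book) (W : Lib) : {ffun 'I_n -> packet F} :=
  [ffun t => c t (msg W (phi t))].

(** The search is joint over all used phases. For an output caused by [W], with [v] the side
    information of [W], the default [W0] is never reached, since [W] itself passes the test. *)
Definition decode (W0 : Lib) (c : book) (k : K) (y : {ffun 'I_n -> chan_out F})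
    (v : nat) : X :=
  want k (odflt W0 [pick W' | (side k W' == v) &&
    [forall (t | rel k (phi t)), (y t == None) || (y t == Some (codeword c W' t))]]).

Let cand k p W := [set msg W' p | W' in [pred W' | side k W' == side k W]].

Definition ambiguous (c : book) (W : Lib) (e : pattern) k p :=
  [exists (a' | (a' \in cand k p W) && (a' != msg W p)),
    [forall (t | (phi t == p) && ~~ e k t), c t a' == c t (msg W p)]].

Hypothesis del01 : forall k, 0 <= del k <= 1.
Hypothesis th01 : 0 <= th <= 1.
Hypothesis decodable : forall k W W', side k W = side k W' ->
  (forall p, rel k p -> msg W p = msg W' p) -> want k W = want k W'.
Hypothesis cand_bound : forall k p W, rel k p -> (#|cand k p W| <= s k p)%N.

(** If no used phase is ambiguous, any library passing the decoder's test agrees with [W] on all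
    used phase messages, and [decodable] applies. *)
Lemma decode_error_ambiguous W0 c W (e : pattern) k :
  decode W0 c k (channel_output (codeword c W) (e k)) (side k W) != want k W ->
  [exists (p | rel k p), ambiguous c W e k p].
Proof.
apply: contraR => /existsPn namb; apply/eqP; rewrite /decode.
case: pickP => [W' /= /andP[/eqP sW' /forallP cons] | /(_ W)]; last first.
  rewrite eqxx /= => /forallPn[t]; rewrite negb_imply ffunE.
  by case: (e k t); rewrite ?eqxx ?orbT ?andbF.
apply: decodable => // p relp; apply/eqP.
have := namb p; rewrite relp /= => /existsPn/(_ (msg W' p)); apply: contraR => neq.
rewrite neq andbT; apply/andP; split; first by apply/imsetP; exists W' => //; rewrite inE sW'.
apply/forallP => t; apply/implyP => /andP[/eqP pt /negPf et].
have := cons t; rewrite pt relp /= ffunE et /= => /eqP [].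
by rewrite !ffunE pt => ->.
Qed.

Lemma sum_ambiguous W (e : pattern) k p : rel k p ->
  \sum_(c : book) (ambiguous c W e k p)%:R <=
  #|{: book}|%:R * (expR (th * ln (s k p)%:R) *
     \prod_(t | phi t == p) (if e k t then 1 else z)).
Proof.
move=> relp; set a := msg W p.
pose T := [pred t | (phi t == p) && ~~ e k t].
have candW : a \in cand k p W by apply/imsetP; exists W; rewrite ?inE.
have s0 : (0 < s k p)%N by apply: leq_trans (cand_bound W relp); apply/card_gt0P; exists a.
have B0 : (0 : R) < #|{: book}|%:R.
  rewrite ltr0n; apply/card_gt0P; exists [ffun=> [ffun=> [ffun=> false]]]; by rewrite inE.
rewrite mulrC -ler_pdivrMr //.
have -> : \prod_(t | phi t == p) (if e k t then 1 else z) = z ^+ #|T|.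
  rewrite -prodr_const big_mkcond [RHS]big_mkcond; apply: eq_bigr => t _.
  by rewrite !inE; case: (phi t == p); case: (e k t).
rewrite /z -expRM_natl -expRD.
rewrite [X in expR X](_ : _ = th * (ln (s k p)%:R - #|T|%:R * (F%:R * ln 2))); last by ring.
(* The fraction of ambiguous codebooks is at most 1, and by a union bound over the candidates at
   most s 2^(-F m) with m = [#|T|]. *)
apply: min1_expR_le => //.
  rewrite ler_pdivrMr // mul1r -sumr_const.
  by apply: ler_sum => c _; case: ambiguous; rewrite ?lexx.
rewrite expRD lnK ?posrE ?ltr0n // ler_pdivrMr // expRN mulrAC.
have -> : expR (#|T|%:R * (F%:R * ln 2)) = (#|{: packet F}| ^ #|T|)%:R :> R.
  by rewrite expRM_natl natrX; congr (_ ^+ _); rewrite expRM_natl lnK ?posrE // card_packet natrX.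
rewrite ler_pdivlMr ?ltr0n ?expn_gt0 ?card_packet ?expn_gt0 //.
rewrite -natr_sum -!natrM ler_nat.
pose coll a' := #|[set c : book | [forall (t | T t), c t a' == c t a]]|.
have H1 : (\sum_(c : book) ambiguous c W e k p <=
    \sum_(a' in cand k p W | a' != a) coll a')%N.
  have -> : (\sum_(a' in cand k p W | a' != a) coll a' =
      \sum_(c : book) \sum_(a' in cand k p W | a' != a)
         [forall (t | T t), c t a' == c t a])%N.
    rewrite exchange_big /=; apply: eq_bigr => a' _; rewrite /coll -sum1_card big_mkcond /=.
    by apply: eq_bigr => c _; rewrite inE; case: ifP.
  apply: leq_sum => c _; case: (boolP (ambiguous c W e k p)) => // /existsP[a' /andP[ca' H]].
  by rewrite (bigD1 a') //= H.
apply: leq_trans (leq_mul H1 (leqnn _)) _; rewrite big_distrl /=.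
apply: leq_trans (_ : \sum_(a' in cand k p W | a' != a) #|{: book}| <= _)%N.
  by apply: leq_sum => a' /andP[_ a'a]; rewrite -card_packet; apply: card_codebook_collision.
rewrite sum_nat_const leq_mul2r; apply/orP; right.
apply: leq_trans (cand_bound W relp); apply: subset_leq_card.
by apply/fintype.subsetP => x /andP[].
Qed.

(** The error averaged over all codebooks obeys the bound, by a union bound over receivers and
    phases; hence some fixed codebook does. *)
Lemma random_coding (W0 : Lib) :
  exists (x : Lib -> {ffun 'I_n -> packet F})
    (dec : K -> {ffun 'I_n -> chan_out F} -> nat -> X),
  \sum_W \sum_(e : pattern) (#|{: Lib}|%:R)^-1 *
     (\prod_k \prod_t (if e k t then del k else 1 - del k)) *
     [exists k, dec k (channel_output (x W) (e k)) (side k W) != want k W]%:R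
  <= \sum_k \sum_(p | rel k p) expR (th * ln (s k p)%:R) *
       (del k + (1 - del k) * z) ^+ #|[pred t | phi t == p]|.
Proof.
set Bd := \sum_k \sum_(p | rel k p) expR (th * ln (s k p)%:R) *
       (del k + (1 - del k) * z) ^+ #|[pred t | phi t == p]|.
pose pr (e : pattern) : R := \prod_k \prod_t (if e k t then del k else 1 - del k).
pose err c W (e : pattern) : bool :=
  [exists k, decode W0 c k (channel_output (codeword c W) (e k)) (side k W) != want k W].
suff [c Hc] : exists c : book, \sum_W \sum_e (#|{: Lib}|%:R)^-1 * pr e * (err c W e)%:R <= Bd.
  by exists (codeword c), (decode W0 c).
have pr0 e : 0 <= pr e.
  apply: prodr_ge0 => k _; apply: prodr_ge0 => t _.
  by have /andP[? ?] := del01 k; case: (e k t); rewrite ?subr_ge0.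
have L0 : (0 : R) < #|{: Lib}|%:R by rewrite ltr0n; apply/card_gt0P; exists W0.
have sumW W : \sum_(c : book) \sum_e pr e * (err c W e)%:R <= #|{: book}|%:R * Bd.
  rewrite exchange_big /=.
  apply: (@le_trans _ _ (\sum_e pr e * \sum_k \sum_(p | rel k p)
      \sum_(c : book) (ambiguous c W e k p)%:R)).
    apply: ler_sum => e _; rewrite -big_distrr /=; apply: ler_wpM2l => //.
    under [leRHS]eq_bigr do rewrite exchange_big /=.
    rewrite [leRHS]exchange_big /=; apply: ler_sum => c _.
    case: (boolP (err c W e)) => [/existsP[k /decode_error_ambiguous/existsP[p /andP[rp Hp]]] | _].
      rewrite (bigD1 k) //= (bigD1 p) //= Hp -addrA ler_wpDr // addr_ge0 //.
        by apply: sumr_ge0.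
      by apply: sumr_ge0 => k' _; apply: sumr_ge0.
    by apply: sumr_ge0 => k' _; apply: sumr_ge0.
  apply: (@le_trans _ _ (\sum_e pr e * \sum_k \sum_(p | rel k p)
     (#|{: book}|%:R * (expR (th * ln (s k p)%:R) *
     \prod_(t | phi t == p) (if e k t then 1 else z))))).
    apply: ler_sum => e _; apply: ler_wpM2l => //.
    by apply: ler_sum => k _; apply: ler_sum => p rp; apply: sum_ambiguous.
  under eq_bigr do rewrite big_distrr /=.
  rewrite exchange_big /= /Bd big_distrr /=; apply: ler_sum => k _.
  under eq_bigr do rewrite big_distrr /=.
  rewrite exchange_big /= big_distrr /=; apply: ler_sum => p _.
  rewrite -(sum_prod_erasure del k [pred t | phi t == p] z) !big_distrr /=.
  by apply: ler_sum => e _; rewrite le_eqVlt; apply/orP; left; apply/eqP; rewrite /pr; ring.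
(* If every codebook were worse than [Bd], so would be the average; strictness needs a codebook to
   exist, and the all-zero one serves. *)
apply: contrapT => /forallNP H.
have : \sum_(c : book) Bd <
   \sum_(c : book) \sum_W \sum_e (#|{: Lib}|%:R)^-1 * pr e * (err c W e)%:R.
  apply: ltr_sum.
    by apply/hasP; exists [ffun=> [ffun=> [ffun=> false]]]; rewrite ?mem_index_enum.
  by move=> c _; rewrite ltNge; apply/negP; apply: H.
apply/negP; rewrite -leNgt sumr_const exchange_big /=.
apply: (@le_trans _ _ (\sum_(W : Lib) (#|{: Lib}|%:R)^-1 * (#|{: book}|%:R * Bd))).
  apply: ler_sum => W _.
  under eq_bigr do under eq_bigr do rewrite -mulrA.
  under eq_bigr do rewrite -big_distrr /=.
  by rewrite -big_distrr /= ler_wpM2l // invr_ge0 ltW.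
by rewrite sumr_const -[leLHS]mulr_natl mulVKf ?gt_eqF // mulr_natl.
Qed.

End RandomCoding.

(** * Cache placement and delivery phases *)

(** This turns a count of free bit positions into a power of 2, for libraries, caches and phase
    loads alike. *)
Lemma card_ffun_off (J : finType) (Q : {set J}) (g0 : {ffun J -> bool}) :
  #|[set g : {ffun J -> bool} | [forall (x | x \notin Q), g x == g0 x]]| = (2 ^ #|Q|)%N.
Proof.
pose h (B : {set J}) : {ffun J -> bool} := [ffun x => if x \in Q then x \in B else g0 x].
rewrite -card_powerset -(@card_in_imset _ _ h); last first.
  move=> B B'; rewrite !inE => /fintype.subsetP BQ /fintype.subsetP B'Q /ffunP e.
  apply/setP => x; have [xQ|xQ] := boolP (x \in Q).
    by have := e x; rewrite !ffunE xQ.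
  by rewrite (contraNF (BQ x) xQ) (contraNF (B'Q x) xQ).
congr #|pred_of_set _|; apply/setP => g; rewrite inE.
apply/forallP/imsetP => [H|[B _ ->] x]; last first.
  by apply/implyP => /negPf xQ; rewrite ffunE xQ.
exists (Q :&: [set x | g x]); first by rewrite inE subsetIl.
apply/ffunP => x; rewrite ffunE !inE; case: (boolP (x \in Q)) => //= xQ.
by have := H x; rewrite xQ => /eqP.
Qed.

Lemma card_masked (I : finType) (Pr : pred I) (w : I -> nat) m :
  (forall i, w i <= m)%N ->
  #|[set x : I * 'I_m | Pr x.1 && (x.2 < w x.1)%N]| = (\sum_(i | Pr i) w i)%N.
Proof.
move=> wm; rewrite -sum1_card [LHS]big_mkcond /=.
rewrite (eq_bigr (fun x : I * 'I_m => (if Pr x.1 && (x.2 < w x.1) then 1 else 0))%N); last first.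
  by move=> x _; rewrite inE.
rewrite -(pair_bigA _ (fun i (u : 'I_m) => (if Pr i && (u < w i) then 1 else 0))%N) /=.
rewrite [RHS]big_mkcond; apply: eq_bigr => i _; case: (Pr i) => /=; last by rewrite big1.
by rewrite -big_mkcond /= -(big_ord_widen m (fun=> 1%N) (wm i)) sum1_card card_ord.
Qed.

Lemma injection_ord (T : finType) (Q : {set T}) L : (L <= #|Q|)%N ->
  exists f : 'I_L -> T, injective f /\ forall w, f w \in Q.
Proof.
move=> LQ; exists (fun w => enum_val (widen_ord LQ w)); split; last by move=> w; apply: enum_valP.
by move=> w w' /enum_val_inj /(congr1 val) /= e; apply: val_inj.
Qed.

Lemma index_by_ord (T B : finType) (h : T -> B) (Q : {set B}) Lc :
  (forall W, h W \in Q) -> (#|Q| <= Lc)%N ->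
  exists g : T -> 'I_Lc, forall W W', g W = g W' -> h W = h W'.
Proof.
move=> hQ QL; have lt W : (index (h W) (enum Q) < Lc)%N.
  by apply: leq_trans QL; rewrite cardE index_mem mem_enum.
exists (fun W => Ordinal (lt W)) => W W' /(congr1 val) /= e.
by rewrite -(nth_index (h W) (s := enum Q) (x := h W)) ?mem_enum // e nth_index ?mem_enum.
Qed.

(* Cell (T, b, u) is bit u of the piece with index T and flag b.  Pieces have at
   most m bits, and bit positions beyond the size [sz #|T| b] are zero. *)
Section CachePlacement.
Variables (Kw Ks D L m : nat) (sz : nat -> bool -> nat) (d : demand Kw Ks D).
Let cell := (({set 'I_Kw} * bool) * 'I_m)%type.
Variable bits : 'I_L -> {ffun cell -> bool}.
Hypothesis szm : forall a b, (a <= Kw)%N -> (sz a b <= m)%N.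
Hypothesis sz0 : sz 0 true = 0%N.
Hypothesis bits_inj : injective bits.
Hypothesis bits_supp : forall w (c : cell), (sz #|c.1.1| c.1.2 <= c.2)%N -> bits w c = false.

Definition cached (i : 'I_Kw) (W : library D L) : {ffun 'I_D * cell -> bool} :=
  [ffun x : 'I_D * cell => (i \in x.2.1.1) && bits (W x.1) x.2].

Definition sent (S : {set 'I_Kw}) (Tb : {set 'I_Kw} * bool) : bool :=
  if S == finset.set0 then ~~ Tb.2 else Tb.2 && (Tb.1 == S).

(** The left summand holds the XORs for the weak receivers, the right one the pieces for the strong
    receivers. Positions not sent are false, so that all phases share one message type; phase 0 is
    the empty set. *)
Definition phase_msg (W : library D L) (S : {set 'I_Kw}) :
    {ffun (bool * 'I_m) + ('I_Ks * cell) -> bool} :=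
  [ffun x : (bool * 'I_m) + ('I_Ks * cell) => match x with
  | inl bu => \big[addb/false]_(k in S) bits (W (d (lshift Ks k))) (S :\ k, bu.1, bu.2)
  | inr jc => sent S jc.2.1 && bits (W (d (rshift Kw jc.1))) jc.2
  end].

(** A piece whose index [T] lacks [i] is recovered in phase [i |: T]: all other terms of that XOR
    have an index containing [i], hence are cached. *)
Lemma weak_decodable i W W' : cached i W = cached i W' ->
  (forall S : {set 'I_Kw}, i \in S -> phase_msg W S = phase_msg W' S) ->
  W (d (lshift Ks i)) = W' (d (lshift Ks i)).
Proof.
move=> /ffunP ec em; have known dd (c : cell) : i \in c.1.1 -> bits (W dd) c = bits (W' dd) c.
  by move=> iT; have := ec (dd, c); rewrite !ffunE iT.
apply: bits_inj; apply/ffunP => -[[T b] u].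
have [iT|iT] := boolP (i \in T); first exact: known.
have iS : i \in i |: T by rewrite setU11.
have /ffunP/(_ (inl (b, u))) := em _ iS; rewrite !ffunE /=.
rewrite (bigD1 i) //= [X in _ = X](bigD1 i) //= setU1K //.
rewrite (eq_bigr (fun k => bits (W' (d (lshift Ks k))) ((i |: T) :\ k, b, u))).
  by move=> /addIb.
move=> k /andP[kS ki]; apply: known => /=.
by rewrite in_setD1 eq_sym ki iS.
Qed.

(** Phase 0 delivers the unflagged pieces and phase [T] the flagged ones with nonempty index [T]; by
    [sz0] flagged pieces with empty index are void. *)
Lemma strong_decodable j W W' :
  (forall S : {set 'I_Kw}, phase_msg W S = phase_msg W' S) ->
  W (d (rshift Kw j)) = W' (d (rshift Kw j)).
Proof.
move=> em; apply: bits_inj; apply/ffunP => -[[T b] u].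
have got S : sent S (T, b) ->
    bits (W (d (rshift Kw j))) (T, b, u) = bits (W' (d (rshift Kw j))) (T, b, u).
  by move=> st; have /ffunP/(_ (inr (j, (T, b, u)))) := em S; rewrite !ffunE /= st.
case: b got => got; last by apply: (got finset.set0); rewrite /sent eqxx.
have [T0|T0] := eqVneq T finset.set0; last by apply: (got T); rewrite /sent (negPf T0) eqxx.
by rewrite !bits_supp //= T0 cards0 sz0.
Qed.

(* log2 of the number of phase-S messages that receiver k has to distinguish. *)
Definition load (k : 'I_(Kw + Ks)) (S : {set 'I_Kw}) : nat :=
  match fintype.split k with
  | inl _ => (sz #|S|.-1 false + sz #|S|.-1 true)%N
  | inr _ => if S == finset.set0 then (Ks * \sum_(T : {set 'I_Kw}) sz #|T| false)%N
             else (sz #|S|.-1 false + sz #|S|.-1 true + Ks * sz #|S| true)%N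
  end.

Lemma card_le_Kw (T : {set 'I_Kw}) : (#|T| <= Kw)%N.
Proof. by rewrite -[X in (_ <= X)%N](card_ord Kw) max_card. Qed.

Lemma card_cached i :
  #|[set x : 'I_D * cell | (i \in x.2.1.1) && (x.2.2 < sz #|x.2.1.1| x.2.1.2)%N]|
  = (D * \sum_(T : {set 'I_Kw} | i \in T) (sz #|T| false + sz #|T| true))%N.
Proof.
have -> : [set x : 'I_D * cell | (i \in x.2.1.1) && (x.2.2 < sz #|x.2.1.1| x.2.1.2)%N]
   = finset.setX finset.setT [set c : cell | (i \in c.1.1) && (c.2 < sz #|c.1.1| c.1.2)%N].
  by apply/setP => x; rewrite !inE.
rewrite cardsX cardsT card_ord; congr (_ * _)%N.
rewrite (card_masked (fun Tb : {set 'I_Kw} * bool => i \in Tb.1)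
  (w := fun Tb => sz #|Tb.1| Tb.2)); last by move=> Tb; apply: szm; apply: card_le_Kw.
under [RHS]eq_bigr do rewrite addnC -(big_bool _ (fun b => sz _ b)).
rewrite pair_big_dep /=; apply: eq_bigl => -[T b]; by rewrite andbT.
Qed.

Lemma card_bits :
  #|[set c : cell | (c.2 < sz #|c.1.1| c.1.2)%N]|
  = (\sum_(T : {set 'I_Kw}) (sz #|T| false + sz #|T| true))%N.
Proof.
rewrite (card_masked predT (w := fun Tb : {set 'I_Kw} * bool => sz #|Tb.1| Tb.2));
  last by move=> Tb; apply: szm; apply: card_le_Kw.
under [RHS]eq_bigr do rewrite addnC -(big_bool _ (fun b => sz _ b)).
by rewrite pair_bigA.
Qed.

Lemma card_phase_pos (S : {set 'I_Kw}) :
  #|[set bu : bool * 'I_m | (bu.2 < sz #|S|.-1 bu.1)%N]| = (sz #|S|.-1 false + sz #|S|.-1 true)%N.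
Proof.
rewrite (card_masked predT (w := fun b => sz #|S|.-1 b)) ?big_bool 1?addnC //.
by move=> b; apply: szm; apply: leq_trans (leq_pred _) (card_le_Kw S).
Qed.

Lemma phase_msg_pos W (S : {set 'I_Kw}) b (u : 'I_m) : (sz #|S|.-1 b <= u)%N ->
  phase_msg W S (inl (b, u)) = false.
Proof.
move=> ub; rewrite ffunE /= big1 // => k kS; apply: bits_supp => /=.
by rewrite (cardsD1 k S) kS add1n /= in ub.
Qed.

(** The piggybacked pieces have index [S], which contains [i], so the cache fixes them and only the
    XOR bits stay free. *)
Lemma weak_load i W (S : {set 'I_Kw}) : i \in S ->
  (#|[set phase_msg W' S | W' in [pred W' | cached i W' == cached i W]]|
     <= 2 ^ load (lshift Ks i) S)%N.
Proof.
move=> iS; rewrite /load (unsplitK (inl i)) -card_phase_pos.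
set Q0 := [set bu : bool * 'I_m | _]; pose Q := @inl _ ('I_Ks * cell)%type @: Q0.
have -> : #|Q0| = #|Q| by rewrite (card_imset _ (@inl_inj _ _)).
rewrite -(card_ffun_off Q (phase_msg W S)); apply: subset_leq_card.
apply/fintype.subsetP => g /imsetP[W' /eqP /ffunP ec ->]; rewrite inE.
apply/forallP => -[[b u]|[j [[T b] u]]]; apply/implyP => nQ.
  have ub : (sz #|S|.-1 b <= u)%N.
    by rewrite leqNgt; apply: contra nQ => H; apply: imset_f; rewrite inE.
  by rewrite !phase_msg_pos.
rewrite !ffunE /= /sent; case: (eqVneq S finset.set0) iS => [->|S0 iS]; first by rewrite inE.
case: (eqVneq T S) => [TS|_] /=; last by rewrite andbF.
by have := ec (d (rshift Kw j), (T, b, u)); rewrite !ffunE /= TS iS /= => ->.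
Qed.

(** Without a cache both summands are free, and the pieces meant for all [Ks] strong receivers
    count. In phase 0 the XOR is empty. *)
Lemma strong_load j (S : {set 'I_Kw}) :
  (#|[set phase_msg W' S | W' : library D L]| <= 2 ^ load (rshift Kw j) S)%N.
Proof.
pose Q0 := if S == finset.set0 then finset.set0
  else [set bu : bool * 'I_m | (bu.2 < sz #|S|.-1 bu.1)%N].
pose C := [set c : cell | sent S c.1 && (c.2 < sz #|c.1.1| c.1.2)%N].
pose Q1 := finset.setX [set: 'I_Ks] C.
pose Q := (@inl _ ('I_Ks * cell)%type @: Q0) :|: (@inr (bool * 'I_m)%type _ @: Q1).
have cardC : #|C| = (\sum_(Tb | sent S Tb) sz #|Tb.1| Tb.2)%N.
  rewrite -(card_masked _ (m := m)) // => Tb.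
  by apply: szm; apply: card_le_Kw.
have cQ : (#|Q| <= load (rshift Kw j) S)%N.
  apply: leq_trans (leq_card_setU _ _) _.
  rewrite (card_imset _ (@inl_inj _ _)) (card_imset _ (@inr_inj _ _)) cardsX cardsT card_ord.
  rewrite /load (unsplitK (inr j)) cardC /Q0; case: ifP => S0.
    rewrite cards0 add0n leq_mul2l; apply/orP; right.
    rewrite (reindex_onto (fun T : {set 'I_Kw} => (T, false)) (fun Tb => Tb.1)) /=.
      by rewrite /sent S0 /= leq_eqVlt; apply/orP; left; apply/eqP; apply: eq_bigl => T; rewrite eqxx.
    by move=> [T b]; rewrite /sent S0 /= => /negPf ->.
  rewrite card_phase_pos leq_add2l leq_mul2l; apply/orP; right.
  rewrite (big_pred1 (S, true)) // => -[T b]; rewrite /sent S0 /= xpair_eqE andbC.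
  by case: b.
apply: (@leq_trans (2 ^ #|Q|)); last by rewrite leq_exp2l.
(* The type of libraries may be empty, and then there is no reference message to compare with. *)
have [W0|noW] := pickP (fun _ : library D L => true); last first.
  rewrite (_ : imset _ _ = finset.set0) ?cards0 //.
  by apply/setP => g; rewrite inE; apply/imsetP => -[W]; have := noW W.
move=> _; rewrite -(card_ffun_off Q (phase_msg W0 S)); apply: subset_leq_card.
apply/fintype.subsetP => g /imsetP[W' _ ->]; rewrite inE.
apply/forallP => -[[b u]|[j' [[T b] u]]]; apply/implyP; rewrite inE => /norP[nQ nQ'].
  case: (eqVneq S finset.set0) => [S0|S0].
    by rewrite !ffunE S0 !big1 // => k; rewrite inE.
  have ub : (sz #|S|.-1 b <= u)%N.
    by rewrite leqNgt; apply: contra nQ => H; apply: imset_f; rewrite /Q0 (negPf S0) inE.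
  by rewrite !phase_msg_pos.
rewrite !ffunE /=; case: (boolP (sent S (T, b))) => //= st.
have ub : (sz #|T| b <= u)%N.
  by rewrite leqNgt; apply: contra nQ' => H; apply: imset_f; rewrite !inE /= st.
by rewrite !bits_supp.
Qed.

End CachePlacement.

(** * Division of the block into phases and assembly of the scheme *)

Lemma phase_allocation (P : finType) (p0 : P) (N : P -> nat) n :
  (\sum_p N p <= n)%N ->
  exists phi : 'I_n -> P, forall p, (N p <= #|[pred t | phi t == p]|)%N.
Proof.
move=> Nn; pose X := {p : P & 'I_(N p)}.
have cX : (#|{: X}| <= n)%N.
  rewrite card_tagged sumnE big_map big_enum /=.
  by under eq_bigr do rewrite card_ord.
pose f (x : X) : 'I_n := widen_ord cX (enum_rank x).
have f_inj : injective f by move=> x y /(congr1 val) /= e; apply: enum_rank_inj; apply: val_inj.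
(* Slots that no phase claims go to [p0]; a longer phase does no harm. *)
exists (fun t => odflt p0 (omap (@tag _ _) [pick x | f x == t])) => p.
have g_inj : injective (fun u : 'I_(N p) => f (Tagged (fun p => 'I_(N p)) u)).
  by move=> u v /f_inj /eqP; rewrite eq_Tagged => /eqP.
rewrite -[X in (X <= _)%N](card_ord (N p)) -cardsT -(card_imset _ g_inj).
apply: subset_leq_card; apply/fintype.subsetP => t /imsetP[u _ ->]; rewrite inE.
by case: pickP => [x /eqP/f_inj -> //|/(_ (Tagged (fun p => 'I_(N p)) u))]; rewrite /= eqxx.
Qed.

Definition listens (Kw Ks : nat) (k : 'I_(Kw + Ks)) (S : {set 'I_Kw}) : bool :=
  if fintype.split k is inl i then i \in S else true.

Lemma exists_scheme (R : realType) (F Kw Ks D n L Lc m : nat) (sz : nat -> bool -> nat)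
    (phi : 'I_n -> {set 'I_Kw}) (dw ds th : R) :
  0 <= dw <= 1 -> 0 <= ds <= 1 -> 0 <= th <= 1 ->
  (forall a b, (a <= Kw)%N -> (sz a b <= m)%N) -> sz 0 true = 0%N ->
  (0 < L)%N -> (L <= 2 ^ \sum_(T : {set 'I_Kw}) (sz #|T| false + sz #|T| true))%N ->
  (forall i : 'I_Kw,
    2 ^ (D * \sum_(T : {set 'I_Kw} | i \in T) (sz #|T| false + sz #|T| true)) <= Lc)%N ->
  exists C : scheme F Kw Ks D n L Lc, forall d : demand Kw Ks D,
    error_prob dw ds C d <= \sum_(k : 'I_(Kw + Ks)) \sum_(S | listens k S)
      expR (th * ln (2 ^ load sz k S)%:R) *
      (delta dw ds k + (1 - delta dw ds k) * expR (- (th * (F%:R * ln 2))))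
        ^+ #|[pred t | phi t == S]|.
Proof.
move=> dw01 ds01 th01 szm sz0 L0 Lsz cachesz.
pose cell := (({set 'I_Kw} * bool) * 'I_m)%type.
have [bits [bits_inj bitsP]] : exists bits : 'I_L -> {ffun cell -> bool},
    injective bits /\ forall w (c : cell), (sz #|c.1.1| c.1.2 <= c.2)%N -> bits w c = false.
  pose Q := [set c : cell | (c.2 < sz #|c.1.1| c.1.2)%N].
  have := @injection_ord _ [set g : {ffun cell -> bool} |
    [forall (x | x \notin Q), g x == [ffun=> false] x]] L.
  rewrite card_ffun_off card_bits // => /(_ Lsz)[f [f_inj fQ]].
  exists f; split=> // w c Hc; have := fQ w; rewrite inE => /forallP/(_ c).
  by rewrite inE -leqNgt Hc ffunE => /eqP.
have /choice[ca caP] : forall i : 'I_Kw, exists g : library D L -> 'I_Lc,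
    forall W W', g W = g W' -> cached bits i W = cached bits i W'.
  move=> i.
  pose Q := [set x : 'I_D * cell | (i \in x.2.1.1) && (x.2.2 < sz #|x.2.1.1| x.2.1.2)%N].
  apply: (@index_by_ord _ _ (cached bits i) [set g : {ffun 'I_D * cell -> bool} |
    [forall (x | x \notin Q), g x == [ffun=> false] x]] Lc).
    move=> W; rewrite inE; apply/forallP => x; apply/implyP; rewrite inE !ffunE.
    by case: (i \in _) => //=; rewrite -leqNgt => /bitsP ->.
  by rewrite card_ffun_off card_cached.
(* Strong receivers get constant side information, which matches the 0 passed to their decoders
   below. *)
pose side (k : 'I_(Kw + Ks)) (W : library D L) : nat :=
  if fintype.split k is inl i then val (ca i W) else 0%N.
have sideE i W W' : side (lshift Ks i) W = side (lshift Ks i) W' ->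
    cached bits i W = cached bits i W'.
  by rewrite /side (unsplitK (inl i)) => /val_inj/caP.
have del01 (k : 'I_(Kw + Ks)) : 0 <= delta dw ds k <= 1 by rewrite /delta; case: ifP.
pose W0 : library D L := [ffun=> Ordinal L0].
pose good (d : demand Kw Ks D) (xd : (library D L -> {ffun 'I_n -> packet F}) *
    ('I_(Kw + Ks) -> {ffun 'I_n -> chan_out F} -> nat -> 'I_L)) :=
  \sum_W \sum_(e : epattern Kw Ks n) (#|{: library D L}|%:R)^-1 *
     (\prod_k \prod_t (if e k t then delta dw ds k else 1 - delta dw ds k)) *
     [exists k, xd.2 k (channel_output (xd.1 W) (e k)) (side k W) != W (d k)]%:R
  <= \sum_(k : 'I_(Kw + Ks)) \sum_(S | listens k S)
      expR (th * ln (2 ^ load sz k S)%:R) *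
      (delta dw ds k + (1 - delta dw ds k) * expR (- (th * (F%:R * ln 2))))
        ^+ #|[pred t | phi t == S]|.
(* Everyone knows the demand, so the codebook may depend on [d]; the placement [bits], [ca] has been
   fixed before. *)
have /choice[xd xdP] : forall d, exists xd, good d xd.
  move=> d.
  have [| |x [dec Hxd]] := @random_coding R F n _ _ _ _ _ (delta dw ds) phi (phase_msg d bits) side
     (@listens Kw Ks) (fun k W => W (d k)) (fun k S => (2 ^ load sz k S)%N) th del01 th01 _ _ W0.
  - move=> k W W'; rewrite -[k]splitK; case: fintype.split => [i|j] /=.
      move=> /sideE eW em; apply: (weak_decodable bits_inj eW) => S iS.
      by apply: em; rewrite /listens (unsplitK (inl i)).
    move=> _ em; apply: (strong_decodable sz0 bits_inj bitsP) => S.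
    by apply: em; rewrite /listens (unsplitK (inr j)).
  - move=> k S W; rewrite -[k]splitK; case: fintype.split => [i|j] /=.
      rewrite /listens (unsplitK (inl i)) => iS.
      apply: leq_trans (weak_load d szm bitsP W iS); apply: subset_leq_card.
      apply/fintype.subsetP => g /imsetP[W']; rewrite inE => /eqP/sideE eW ->.
      by apply: imset_f; rewrite inE eW.
    move=> _; apply: leq_trans (strong_load d szm bitsP j S); apply: subset_leq_card.
    by apply/fintype.subsetP => g /imsetP[W' _ ->]; apply: imset_f.
  - by exists (x, dec).
exists (Scheme ca (fun d => (xd d).1)
  (fun d i y v => (xd d).2 (lshift Ks i) y (val v))
  (fun d j y => (xd d).2 (rshift Kw j) y 0%N)) => d.
apply: le_trans (xdP d); rewrite /error_prob /pattern_prob.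
apply: ler_sum => W _; apply: ler_sum => e _; apply: ler_wpM2l.
  rewrite mulr_ge0 ?invr_ge0 //; apply: prodr_ge0 => k _; apply: prodr_ge0 => t _.
  by have /andP[? ?] := del01 k; case: (e k t); rewrite ?subr_ge0.
rewrite ler_nat; case: (boolP (some_error _ _ _ _)) => //.
move=> /orP[/existsP[i Hi]|/existsP[j Hj]]; rewrite lt0b; apply/existsP.
  by exists (lshift Ks i); rewrite /side (unsplitK (inl i)).
by exists (rshift Kw j); rewrite /side (unsplitK (inr j)).
Qed.

(** * Achievability of feasible piece sizes *)

Lemma sum_by_card (V : nmodType) (Kw : nat) (f : nat -> V) :
  \sum_(T : {set 'I_Kw}) f #|T| = \sum_(a < Kw.+1) f a *+ 'C(Kw, a).
Proof.
rewrite (partition_big (fun T : {set 'I_Kw} => inord #|T| : 'I_Kw.+1) predT) //=.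
apply: eq_bigr => a _.
transitivity (f a *+ #|[set T : {set 'I_Kw} | T \subset [set: 'I_Kw] & #|T| == a]|); last first.
  by rewrite cards_draws cardsT card_ord.
rewrite -sumr_const [RHS](eq_bigr (fun T : {set 'I_Kw} => f #|T|)).
  apply: eq_bigl => T; rewrite inE finset.subsetT /=.
  by apply/eqP/eqP => [<-|->]; rewrite ?inordK ?inord_val ?ltnS ?card_le_Kw //.
by move=> T; rewrite inE => /andP[_ /eqP ->].
Qed.

(** By symmetry under transpositions the sum does not depend on [i], and summing over all receivers
    counts each [T] exactly [#|T|] times. *)
Lemma sum_containing (R : pzRingType) (Kw : nat) (f : nat -> R) (i : 'I_Kw) :
  Kw%:R * \sum_(T : {set 'I_Kw} | i \in T) f #|T| =
  \sum_(a < Kw.+1) a%:R * f a *+ 'C(Kw, a).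
Proof.
rewrite -(sum_by_card Kw (fun a => a%:R * f a)).
transitivity (\sum_(j < Kw) \sum_(T : {set 'I_Kw} | j \in T) f #|T|).
  rewrite -[in Kw%:R](card_ord Kw) mulr_natl -sumr_const; apply: eq_bigr => j _.
  pose h (T : {set 'I_Kw}) := tperm i j @: T.
  have h_inj : injective h by apply: imset_inj; apply: perm_inj.
  rewrite [RHS](reindex_inj h_inj); apply: eq_big => T.
    by rewrite -(mem_imset _ i (@perm_inj _ (tperm i j))) tpermL.
  by move=> _; rewrite /h card_imset //; apply: perm_inj.
rewrite (exchange_big_dep predT) //=; apply: eq_bigr => T _.
by rewrite sumr_const mulr_natl.
Qed.

Section Rates.
Variable R : realType.

(** With th = u / (F ln 2) each received symbol gains a factor e^(-u). To first order in [u] the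
    phase length pays for the load with slack [eta]; the second-order loss costs at most [u] of it.
    The -1 allows for rounding the phase length. *)
Lemma phase_decay (F n q N : nat) (dl nu eta u : R) :
  (0 < F)%N -> 0 < u -> 0 <= dl <= 1 -> nu <= 1 -> 0 <= nu ->
  n%:R * nu - 1 <= N%:R -> q%:R <= F%:R * (1 - dl) * n%:R * (nu - eta) ->
  expR (u / (F%:R * ln 2) * ln (2 ^ q)%:R) *
    (dl + (1 - dl) * expR (- (u / (F%:R * ln 2) * (F%:R * ln 2)))) ^+ N
  <= expR ((1 - dl) * u * (1 - n%:R * (eta - u))).
Proof.
move=> F0 u0 /andP[dl0 dl1] nu1 nu0 HN Hq.
have ln20 : 0 < ln (2 : R) by rewrite ln_gt0 // ltr1n.
have FR : (0 : R) < F%:R by rewrite ltr0n.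
rewrite divfK ?mulf_neq0 ?gt_eqF // natrX lnXn ?ltr0n //.
have -> : u / (F%:R * ln 2) * (ln 2 *+ q) = u * (q%:R / F%:R).
  by rewrite -mulr_natr; field; rewrite !gt_eqF.
set x := 1 - expR (- u).
have x_ge : u * (1 - u) <= x.
  rewrite /x expRN; have e1 := expR_ge1Dx u.
  have : (expR u)^-1 <= (1 + u)^-1 by rewrite lef_pV2 ?posrE ?expR_gt0 //; lra.
  have : (1 + u)^-1 <= 1 - u * (1 - u).
    have up : 0 < 1 + u by lra.
    rewrite -[leLHS]mul1r ler_pdivrMr //.
    have : 0 <= u * u * u by rewrite !mulr_ge0 // ltW.
    lra.
  lra.
have x_le : x <= u by have := expR_ge1Dx (- u); rewrite /x; lra.
have x0 : 0 <= x by rewrite /x subr_ge0 -[leRHS]expR0 ler_expR; lra.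
(* The base equals 1 - (1 - dl) x. *)
have base_le : dl + (1 - dl) * expR (- u) <= expR (- ((1 - dl) * x)).
  by apply: le_trans (expR_ge1Dx _); rewrite /x; lra.
have base0 : 0 <= dl + (1 - dl) * expR (- u).
  by rewrite addr_ge0 // mulr_ge0 ?subr_ge0 // expR_ge0.
apply: (@le_trans _ _ (expR (u * (q%:R / F%:R)) * expR (- ((1 - dl) * x)) ^+ N)).
  by rewrite ler_wpM2l ?expR_ge0 // lerXn2r ?nnegrE ?expR_ge0.
rewrite -expRM_natl -expRD ler_expR.
have qF : q%:R / F%:R <= (1 - dl) * n%:R * (nu - eta).
  by rewrite ler_pdivrMr //; apply: le_trans Hq _; rewrite le_eqVlt; apply/orP; left; apply/eqP; ring.
have h1 : u * (q%:R / F%:R) <= u * ((1 - dl) * n%:R * (nu - eta)) by rewrite ler_wpM2l // ltW.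
have n0 : (0 : R) <= n%:R by [].
have h2 : n%:R * nu * (u * (1 - u)) - u <= N%:R * x.
  apply: (@le_trans _ _ ((n%:R * nu - 1) * x)); last by rewrite ler_wpM2r.
  have : n%:R * nu * (u * (1 - u)) <= n%:R * nu * x by rewrite ler_wpM2l // mulr_ge0.
  lra.
have h3 : (1 - dl) * (n%:R * nu * (u * (1 - u)) - u) <= (1 - dl) * (N%:R * x).
  by rewrite ler_wpM2l // subr_ge0.
have h4 : (1 - dl) * (n%:R * (u * u)) * nu <= (1 - dl) * (n%:R * (u * u)).
  by rewrite ler_piMr // !mulr_ge0 ?subr_ge0 // ltW.
apply: le_trans (lerD h1 (_ : _ <= - ((1 - dl) * (n%:R * nu * (u * (1 - u)) - u)))) _.
  by move: h3; rewrite -lerN2; apply: le_trans; rewrite le_eqVlt; apply/orP; left; apply/eqP; ring.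
by rewrite -subr_ge0; move: h4; rewrite -subr_ge0; congr (_ <= _); ring.
Qed.

(* [al a] and [be a] are the sizes, in bits per channel use, of the unflagged and
   flagged pieces with index of cardinality a.  The third condition says that a
   phase long enough for its weak receivers has room for the piggybacked pieces;
   the fourth that the phases fit into the block; the last one computes the
   rate, and the memory after summing over the Kw weak receivers. *)
Definition feasible (F Kw Ks D : nat) (dw ds : R) (al be : nat -> R) (r m : R) : Prop :=
  [/\ (forall a, 0 <= al a) /\ (forall a, 0 <= be a), be 0%N = 0,
      forall a, (a < Kw)%N -> Ks%:R * be a.+1 * (1 - dw) <= (al a + be a) * (dw - ds),
      (\sum_(a < Kw) (al a + be a) *+ 'C(Kw, a.+1)) / (1 - dw) +
        Ks%:R * (\sum_(a < Kw.+1) al a *+ 'C(Kw, a)) / (1 - ds) <= F%:R &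
      r = \sum_(a < Kw.+1) (al a + be a) *+ 'C(Kw, a) /\
      D%:R * \sum_(a < Kw.+1) a%:R * (al a + be a) *+ 'C(Kw, a) = Kw%:R * m].
End Rates.

Section Achievability.
Variable R : realType.

Lemma natrX2_powR (k : nat) : (2 ^ k)%:R = 2 `^ (k%:R : R) :> R.
Proof. by rewrite natrX powR_mulrn. Qed.

Lemma nvals_gt0 n (r : R) : 0 <= r -> (0 < nvals n r)%N.
Proof.
move=> r0; rewrite /nvals truncn_gt0 -[leLHS](@powRr0 _ 2); apply: ler_powR.
  by rewrite ler1n.
by rewrite mulr_ge0.
Qed.

Lemma nvals_le n (r : R) k : n%:R * r <= k%:R -> (nvals n r <= 2 ^ k)%N.
Proof.
move=> h; rewrite -(ler_nat R) natrX2_powR.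
apply: (@le_trans _ _ (2 `^ (n%:R * r))); first by rewrite truncn_le powR_ge0.
by apply: ler_powR; rewrite ?ler1n.
Qed.

Lemma nvals_ge n (m : R) k : k%:R <= n%:R * m -> (2 ^ k <= nvals n m)%N.
Proof.
move=> h; rewrite /nvals truncn_ge_nat ?powR_ge0 // natrX2_powR.
by apply: ler_powR; rewrite ?ler1n.
Qed.

Lemma exp_decay_le (A c eta eps : R) : 0 < c -> 0 < eta -> 0 < eps ->  0 <= A ->
  exists N : nat, forall n, (N <= n)%N -> A * expR (c * (1 - n%:R * eta)) <= eps.
Proof.
move=> c0 eta0 eps0 A0; exists (Num.truncn ((A / (eps * c) + 1) / eta)).+1 => n Nn.
have h : (A / (eps * c) + 1) / eta <= n%:R.
  by apply: (le_trans (ltW (truncnS_gt _))); rewrite ler_nat.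
have {}h : A / eps <= c * (n%:R * eta - 1).
  have : A / (eps * c) + 1 <= n%:R * eta by rewrite -ler_pdivrMr.
  rewrite -lerBrDr => /(ler_wpM2l (ltW c0)); apply: le_trans.
  by rewrite le_eqVlt; apply/orP; left; apply/eqP; field; rewrite !gt_eqF.
have -> : c * (1 - n%:R * eta) = - (c * (n%:R * eta - 1)) by ring.
rewrite expRN ler_pdivrMr ?expR_gt0 // mulrC -ler_pdivrMr //.
apply: le_trans h _; apply: le_trans (expR_ge1Dx _); lra.
Qed.

(** The feasible sizes are scaled by [n * kap] with [kap] below 1 and rounded down. The rate given
    up pays for the rounding, and the time share 1 - [kap] is spread over the phases as slack. *)
Lemma feasible_achievable (F Kw Ks D : nat) (dw ds : R) al be r m r' :
  (0 < F)%N -> (0 < Kw)%N -> 0 < ds -> ds <= dw -> dw < 1 ->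
  feasible F Kw Ks D dw ds al be r m -> 0 <= r' -> r' < r ->
  achievable F Kw Ks D dw ds r' m.
Proof.
move=> F0 Kw0 ds0 dsw dw1 [[al0 be0] be00 piggy time [rE mE]] r'0 r'r.
have FR : (0 : R) < F%:R by rewrite ltr0n.
have KR : (0 : R) < Kw%:R by rewrite ltr0n.
have r0 : 0 < r by apply: le_lt_trans r'r.
have cw : 0 < 1 - dw by rewrite subr_gt0.
have cs : 0 < 1 - ds by rewrite subr_gt0 (le_lt_trans dsw).
pose ga a := al a + be a.
have ga0 a : 0 <= ga a by rewrite addr_ge0.
have m0 : 0 <= m.
  rewrite -(pmulr_rge0 _ KR) -mE mulr_ge0 // sumr_ge0 // => a _.
  by rewrite mulrn_wge0 // mulr_ge0 // ga0.
split=> //; split=> // eps eps0.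
have {}rE : r = \sum_(T : {set 'I_Kw}) ga #|T| by rewrite sum_by_card.
have {}mE i : D%:R * \sum_(T : {set 'I_Kw} | i \in T) ga #|T| = m.
  apply: (mulfI (lt0r_neq0 KR)); rewrite mulrCA (sum_containing ga i).
  exact: mE.
pose P := #|{: {set 'I_Kw}}|%:R : R.
have P0 : 0 < P by rewrite ltr0n; apply/card_gt0P; exists finset.set0.
(* Chosen so that [kap * r] is the midpoint of [r'] and [r]. *)
pose kap := (r' / r + 1) / 2.
have kap_r : kap * r = (r' + r) / 2 by rewrite /kap; field; rewrite gt_eqF.
have kap1 : kap < 1.
  have : r' / r < 1 by rewrite ltr_pdivrMr // mul1r.
  by rewrite /kap; lra.
have kap0 : 0 <= kap by have : 0 <= r' / r; [rewrite divr_ge0 // ltW | rewrite /kap; lra].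
pose eta := (1 - kap) / P.
have eta0 : 0 < eta by rewrite divr_gt0 // subr_gt0.
(* nu S is the time share that phase S needs; mixing it with the uniform
   distribution leaves every phase a slack proportional to n. *)
pose nu (S : {set 'I_Kw}) : R := if S == finset.set0
  then Ks%:R * (\sum_(T : {set 'I_Kw}) al #|T|) / (F%:R * (1 - ds))
  else ga #|S|.-1 / (F%:R * (1 - dw)).
have nu0 S : 0 <= nu S.
  rewrite /nu; case: ifP => _; rewrite divr_ge0 ?mulr_ge0 ?sumr_ge0 // ltW //.
have sum_nu : \sum_S nu S <= 1.
  rewrite (bigD1 finset.set0) //= {1}/nu eqxx.
  have -> : \sum_(S | S != finset.set0) nu S =
      (\sum_(S : {set 'I_Kw} | S != finset.set0) ga #|S|.-1) / (F%:R * (1 - dw)).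
    by rewrite mulr_suml; apply: eq_bigr => S /negPf S0; rewrite /nu S0.
  have -> : \sum_(S : {set 'I_Kw} | S != finset.set0) ga #|S|.-1 =
      \sum_(a < Kw) (al a + be a) *+ 'C(Kw, a.+1).
    (* The value 0 at cardinality 0 removes the empty set, so that the sum can be grouped by
       cardinality. *)
    have := sum_by_card Kw (fun a => if a == 0%N then 0 else ga a.-1).
    rewrite big_ord_recl /= mul0rn add0r => <-; rewrite big_mkcond /=.
    by apply: eq_bigr => S _; rewrite cards_eq0; case: eqP.
  rewrite sum_by_card addrC -(ler_pM2l FR) mulr1; apply: le_trans time.
  by rewrite le_eqVlt; apply/orP; left; apply/eqP; field; rewrite !gt_eqF.
have nu1 S : nu S <= 1.
  by apply: le_trans sum_nu; rewrite (bigD1 S) //= lerDl sumr_ge0.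
pose nu' S := kap * nu S + eta.
have nu'0 S : 0 <= nu' S by apply: addr_ge0; [exact: mulr_ge0 | exact: ltW].
have sum_nu' : \sum_S nu' S <= 1.
  rewrite big_split /= -mulr_sumr sumr_const -[_ *+ _]mulr_natr -/P divfK ?gt_eqF //.
  have : kap * \sum_S nu S <= kap by rewrite ler_piMr.
  by lra.
have nu'1 S : nu' S <= 1.
  by apply: le_trans sum_nu'; rewrite (bigD1 S) //= lerDl sumr_ge0.
(* The first bound keeps half of the slack [eta] in [phase_decay]; the second makes the exponent
   [th] at most 1. *)
pose u := Num.min (eta / 2) (F%:R * ln 2).
have ln20 : 0 < ln (2 : R) by rewrite ln_gt0 // ltr1n.
have u0 : 0 < u by rewrite lt_min divr_gt0 //= mulr_gt0.
have u_eta : u <= eta / 2 by rewrite ge_min lexx.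
have th01 : 0 <= u / (F%:R * ln 2) <= 1.
  have FL : 0 < F%:R * ln (2 : R) by rewrite mulr_gt0.
  by rewrite divr_ge0 ?(ltW u0) ?(ltW FL) //= ler_pdivrMr // mul1r ge_min lexx orbT.
(* The union bound has at most [(Kw + Ks) * P] terms, and 1 - [dw] gives the slowest decay among
   them. *)
have [N1 HN1] := exp_decay_le (mulr_gt0 cw u0) (divr_gt0 eta0 (ltr0n R 2)) eps0
  (mulr_ge0 (ler0n R (Kw + Ks)) (ltW P0)).
(* Rounding loses at most two bits per index set, [2 * P] in all, which [N2] makes up for; [N3]
   ensures [2 <= n * eta]. *)
pose N2 := (Num.truncn (2 * P / (kap * r - r'))).+1.
pose N3 := (Num.truncn (2 / eta)).+1.
exists (maxn N1 (maxn N2 N3)) => n; rewrite !geq_max => /and3P[n1 n2 n3].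
pose sz a (b : bool) := Num.truncn (n%:R * kap * (if b then be a else al a)).
have sz_le a b : (sz a b)%:R <= n%:R * kap * (if b then be a else al a).
  by rewrite truncn_le; apply: mulr_ge0; [exact: mulr_ge0 | case: b].
have sz2_le a : (sz a false + sz a true)%:R <= n%:R * kap * ga a.
  by rewrite natrD /ga mulrDr; apply: lerD; apply: (sz_le a _).
have sz2_ge a : n%:R * kap * ga a - 2 <= (sz a false + sz a true)%:R.
  have h b : n%:R * kap * (if b then be a else al a) - 1 <= (sz a b)%:R.
    by rewrite lerBlDr natr1 ltW // truncnS_gt.
  by have := h false; have := h true; rewrite /ga natrD /=; lra.
have [phi phiP] : exists phi : 'I_n -> {set 'I_Kw},
    forall S, (Num.truncn (n%:R * nu' S) <= #|[pred t | phi t == S]|)%N.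
  apply: (phase_allocation finset.set0); rewrite -(ler_nat R) natr_sum.
  apply: (@le_trans _ _ (\sum_S n%:R * nu' S)).
    by apply: ler_sum => S _; rewrite truncn_le mulr_ge0.
  by rewrite -mulr_sumr ler_piMr.
pose M := (\sum_(a < Kw.+1) \sum_b sz a b)%N.
have szM a b : (a <= Kw)%N -> (sz a b <= M)%N.
  move=> aK; rewrite /M (bigD1 (inord a : 'I_Kw.+1)) //= (bigD1 b) //= inordK //.
  by rewrite -addnA leq_addr.
have [] := @exists_scheme R F Kw Ks D n (nvals n r') (nvals n m) M sz phi dw ds (u / (F%:R * ln 2)) _ _ th01 szM.
- by rewrite (le_trans (ltW ds0) dsw) ltW.
- by rewrite ltW //= (le_trans dsw) // ltW.
- by rewrite /sz be00 mulr0 truncn0.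
- exact: nvals_gt0.
- apply: nvals_le; rewrite natr_sum.
  apply: (@le_trans _ _ (\sum_(T : {set 'I_Kw}) (n%:R * kap * ga #|T| - 2))); last exact: ler_sum.
  rewrite sumrB -mulr_sumr -rE sumr_const -[_ *+ _]mulr_natr -/P.
  have : 2 * P / (kap * r - r') <= n%:R.
    by apply: (le_trans (ltW (truncnS_gt _))); rewrite ler_nat.
  rewrite ler_pdivrMr; last by rewrite kap_r; lra.
  by lra.
- move=> i; apply: nvals_ge; rewrite natrM natr_sum -(mE i).
  rewrite mulrCA ler_wpM2l // mulr_sumr; apply: ler_sum => T _.
  apply: le_trans (sz2_le _) _; rewrite -mulrA ler_wpM2l // ler_piMl //; exact: ltW.
move=> C HC; exists C => d; apply: le_trans (HC d) _; apply: le_trans (HN1 n n1).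
have term (k : 'I_(Kw + Ks)) S : listens k S ->
   expR (u / (F%:R * ln 2) * ln (2 ^ load sz k S)%:R) *
      (delta dw ds k + (1 - delta dw ds k) * expR (- (u / (F%:R * ln 2) * (F%:R * ln 2))))
        ^+ #|[pred t | phi t == S]|
   <= expR ((1 - dw) * u * (1 - n%:R * (eta / 2))).
  move=> lis; apply: (@le_trans _ _ (expR ((1 - delta dw ds k) * u * (1 - n%:R * (eta - u))))).
    apply: (phase_decay (nu := nu' S)) => //.
    - by rewrite /delta; case: ifP => _; apply/andP; split; lra.
    - apply: (@le_trans _ _ (Num.truncn (n%:R * nu' S))%:R).
        by rewrite lerBlDr natr1 ltW // truncnS_gt.
      by rewrite ler_nat.
    have -> : nu' S - eta = kap * nu S by rewrite /nu'; ring.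
    have sub1 : (sz #|S|.-1 false + sz #|S|.-1 true)%:R <= n%:R * kap * ga #|S|.-1 by apply: sz2_le.
    move: lis; rewrite /listens /load -[k]splitK; case: (fintype.split k) => [i|j] /=.
      rewrite (unsplitK (inl i)) => iS.
      rewrite /delta /= ltn_ord /nu; case: eqVneq iS => [->|S0 iS]; first by rewrite inE.
      apply: le_trans sub1 _; rewrite le_eqVlt; apply/orP; left; apply/eqP.
      by field; rewrite !gt_eqF.
    rewrite (unsplitK (inr j)) => _.
    rewrite /delta /= ltnNge leq_addr /= /nu; case: eqVneq => [_|S0].
      rewrite natrM natr_sum.
      apply: (@le_trans _ _ (Ks%:R * \sum_(T : {set 'I_Kw}) n%:R * kap * al #|T|)).
        by rewrite ler_wpM2l //; apply: ler_sum => T _; apply: (sz_le _ false).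
      rewrite -mulr_sumr le_eqVlt; apply/orP; left; apply/eqP.
      by field; rewrite !gt_eqF.
    rewrite natrD natrM.
    apply: (@le_trans _ _ (n%:R * kap * (ga #|S|.-1 + Ks%:R * be #|S|))).
      rewrite mulrDr lerD // mulrCA ler_wpM2l //; exact: (sz_le _ true).
    have -> : F%:R * (1 - ds) * n%:R * (kap * (ga #|S|.-1 / (F%:R * (1 - dw)))) =
       n%:R * kap * (ga #|S|.-1 * (1 - ds) / (1 - dw)) by field; rewrite !gt_eqF.
    apply: ler_wpM2l; first exact: mulr_ge0.
    rewrite ler_pdivlMr //.
    have S1 : #|S|.-1.+1 = #|S| by rewrite prednK // card_gt0.
    (* A phase dimensioned for the weak receivers lets a strong one decode (1 - ds) / (1 - dw) times
       their load; [piggy] says that the extra pieces fit in. *)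
    have := piggy #|S|.-1; rewrite S1 -/(ga _) => /(_ (card_le_Kw S)); lra.
  rewrite ler_expR.
  have n_eta : 2 / eta <= n%:R.
    by apply: (le_trans (ltW (truncnS_gt _))); rewrite ler_nat.
  have {}n_eta : 2 <= n%:R * eta by rewrite -ler_pdivrMr.
  have del_dw : 1 - dw <= 1 - delta dw ds k by rewrite /delta; case: ifP => _; lra.
  have nn0 : (0 : R) <= n%:R by [].
  have n_u : n%:R * u <= n%:R * (eta / 2) by rewrite ler_wpM2l.
  apply: (@le_trans _ _ ((1 - delta dw ds k) * u * (1 - n%:R * (eta / 2)))).
    apply: ler_wpM2l; last by lra.
    apply: mulr_ge0; last exact: ltW.
    exact: le_trans (ltW cw) del_dw.
  (* The bracket is nonpositive by the choice of [N3], so a larger 1 - [delta] only speeds up the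
     decay. *)
  apply: ler_wnM2r; first by lra.
  by apply: ler_wpM2r; first exact: ltW.
apply: (@le_trans _ _ (\sum_(k : 'I_(Kw + Ks)) \sum_(S : {set 'I_Kw})
  expR ((1 - dw) * u * (1 - n%:R * (eta / 2))))).
  apply: ler_sum => k _; rewrite big_mkcond /=; apply: ler_sum => S _.
  by case: ifP => [/term //|_]; apply: expR_ge0.
by rewrite !sumr_const card_ord -[leLHS]mulr_natl -[X in _ * X]mulr_natl mulrA.
Qed.

End Achievability.

(** * Corner points *)

Section CornerPoints.
Variable R : realType.

(** The condition on [c] covers a level outside the range of summation, as happens with vanishing
    binomials. *)
Lemma sum_level (N s : nat) (x : R) (f : R -> nat -> R) (c : nat -> nat) :
  (forall a, f 0 a = 0) -> ((N <= s)%N -> c s = 0%N) ->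
  \sum_(a < N) f (if a == s :> nat then x else 0) a *+ c a = f x s *+ c s.
Proof.
move=> f0 cs; have [sN|Ns] := ltnP s N; last first.
  rewrite cs // mulr0n big1 // => a _; case: eqP => [as'|_]; last by rewrite f0 mul0rn.
  by move: (ltn_ord a); rewrite as' ltnNge Ns.
rewrite (bigD1 (Ordinal sN)) //= eqxx big1 ?addr0 // => a /negPf as'.
by rewrite -val_eqE /= in as'; rewrite as' f0 mul0rn.
Qed.

(* X and Y are the total rates of the unflagged pieces at level s and of the
   flagged pieces at level s + 1. *)
Lemma feasible_two_level (F Kw Ks D s : nat) (dw ds X Y m : R) :
  ds <= dw -> dw < 1 -> (s <= Kw)%N -> 0 <= X -> 0 <= Y -> (s = Kw -> Y = 0) ->
  Ks%:R * Y * (1 - dw) * s.+1%:R <= X * (Kw%:R - s%:R) * (dw - ds) ->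
  (X * ((Kw%:R - s%:R) / s.+1%:R) + Y * ((Kw%:R - s.+1%:R) / s.+2%:R)) / (1 - dw) +
    Ks%:R * X / (1 - ds) <= F%:R ->
  D%:R * (s%:R * X + s.+1%:R * Y) = Kw%:R * m ->
  exists al be, feasible F Kw Ks D dw ds al be (X + Y) m.
Proof.
move=> dsw dw1 sK X0 Y0 YK piggy time mem.
have binS (a : nat) : (a <= Kw)%N -> ('C(Kw, a.+1)%:R : R) = 'C(Kw, a)%:R * ((Kw%:R - a%:R) / a.+1%:R).
  move=> aK; apply: (mulfI (_ : a.+1%:R != 0)); first by rewrite pnatr_eq0.
  by rewrite -natrM mul_bin_left natrM natrB // [RHS]mulrC -mulrA divfK ?pnatr_eq0 // mulrC.
have Cs : (0 : R) < 'C(Kw, s)%:R by rewrite ltr0n bin_gt0.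
pose x := X / 'C(Kw, s)%:R; pose y := Y / 'C(Kw, s.+1)%:R.
have xX : x *+ 'C(Kw, s) = X by rewrite -mulr_natr divfK ?gt_eqF.
(* For [s = Kw] the binomial is 0 and the identity rests on [Y = 0]. *)
have yY : y *+ 'C(Kw, s.+1) = Y.
  move: sK; rewrite leq_eqVlt => /orP[/eqP sK|sK].
    by rewrite /y YK // mul0r mul0rn.
  by rewrite -mulr_natr divfK // pnatr_eq0 -lt0n bin_gt0.
have x0 : 0 <= x by rewrite divr_ge0 // ltW.
have y0 : 0 <= y by rewrite divr_ge0.
pose al (a : nat) : R := if a == s then x else 0.
pose be (a : nat) : R := if a == s.+1 then y else 0.
have sum_at (N k : nat) (z : R) (g : nat -> R) (c : nat -> nat) :
    (N <= k -> c k = 0)%N ->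
    \sum_(a < N) g a * (if a == k :> nat then z else 0) *+ c a = g k * z *+ c k.
  by move=> ck; apply: (@sum_level N k z (fun z a => g a * z) c) => // a; rewrite mulr0.
have sum_ab N (g : nat -> R) (c : nat -> nat) :
    (N <= s -> c s = 0)%N -> (N <= s.+1 -> c s.+1 = 0)%N ->
    \sum_(a < N) g a * (al a + be a) *+ c a = g s * x *+ c s + g s.+1 * y *+ c s.+1.
  move=> cs cs1; rewrite -(sum_at N s) // -(sum_at N s.+1) // -big_split.
  by apply: eq_bigr => a _; rewrite /= mulrDr mulrnDl.
have big (a : nat) : (Kw.+1 <= a)%N -> 'C(Kw, a) = 0%N by move=> h; rewrite bin_small.
exists al; exists be; split.
- by split=> a; rewrite /al /be; case: ifP.
- by [].
- move=> a aK; rewrite /al /be eqSS; case: eqVneq => [as'|_]; last first.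
    by rewrite mulr0 mul0r mulr_ge0 ?subr_ge0 //; case: ifP => _; rewrite ?add0r ?addr0.
  subst a; rewrite ltn_eqF // addr0 -(ler_pM2l Cs).
  have -> : 'C(Kw, s)%:R * (x * (dw - ds)) = X * (dw - ds) by rewrite mulrA [_ * x]mulrC divfK ?gt_eqF.
  have kp : (0 : R) < (Kw%:R - s%:R) by rewrite subr_gt0 ltr_nat.
  have e : 'C(Kw, s)%:R * y * (Kw%:R - s%:R) = Y * s.+1%:R.
    rewrite -yY -[y *+ _]mulr_natr binS //; field.
    by rewrite addrC natr1 pnatr_eq0.
  rewrite -(ler_pM2r kp); move: piggy; congr (_ <= _); last by ring.
  by transitivity (Ks%:R * (1 - dw) * ('C(Kw, s)%:R * y * (Kw%:R - s%:R))); [rewrite e|]; ring.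
- have -> : \sum_(a < Kw) (al a + be a) *+ 'C(Kw, a.+1) = x *+ 'C(Kw, s.+1) + y *+ 'C(Kw, s.+2).
    rewrite -[x]mul1r -[y]mul1r -(sum_ab Kw (fun=> 1) (fun a => 'C(Kw, a.+1))).
    - by apply: eq_bigr => a _; rewrite mul1r.
    - by move=> h; apply: big.
    - by move=> h; apply: big; apply: leq_trans h _.
  have -> : \sum_(a < Kw.+1) al a *+ 'C(Kw, a) = X.
    rewrite -xX -[x]mul1r -(sum_at Kw.+1 s _ (fun=> 1) (fun a => 'C(Kw, a))); last exact: big.
    by apply: eq_bigr => a _; rewrite mul1r.
  apply: le_trans time; rewrite le_eqVlt; apply/orP; left; apply/eqP.
  congr (_ / _ + _ ); congr (_ + _).
    by rewrite -[x *+ _]mulr_natr binS // (mulrA x) mulr_natr xX.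
  move: sK; rewrite leq_eqVlt => /orP[/eqP sK|sK].
    by rewrite /y YK // !mul0r mul0rn.
  by rewrite -[y *+ _]mulr_natr (binS s.+1) // (mulrA y) mulr_natr yY.
- split.
    rewrite -xX -yY -[x]mul1r -[y]mul1r.
    rewrite -(sum_ab Kw.+1 (fun=> 1) (fun a => 'C(Kw, a))); [|exact: big|exact: big].
    by apply: eq_bigr => a _; rewrite mul1r.
  rewrite -mem; congr (_ * _).
  rewrite (sum_ab _ (fun a => a%:R) (fun a => 'C(Kw, a))); [|exact: big|exact: big].
  by rewrite -[_ * x *+ _]mulrnAr -[_ * y *+ _]mulrnAr xX yY.
Qed.

(** For [t = 0] all pieces sit at level 0 and nothing is cached; for [t = Kw + 1] all sit at level
    [Kw] and each weak receiver caches the library. In between, levels [t - 1] and [t] are mixed. *)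
Lemma feasible_point (F Kw Ks D : nat) (dw ds : R) (t : nat) :
  (0 < Kw)%N -> (0 < Ks)%N -> 0 < ds -> ds <= dw -> dw < 1 -> (t <= Kw.+1)%N ->
  exists al be, feasible F Kw Ks D dw ds al be
    (Rpt F Kw Ks dw ds t) (Mpt F Kw Ks D dw ds t).
Proof.
move=> Kw0 Ks0 ds0 dsw dw1 tK.
have cw : 0 < 1 - dw by rewrite subr_gt0.
have cs : 0 < 1 - ds by rewrite subr_gt0 (le_lt_trans dsw).
have KR : (0 : R) < Kw%:R by rewrite ltr0n.
have KsR : (0 : R) < Ks%:R by rewrite ltr0n.
have FR : (0 : R) <= F%:R by [].
have d0 : 0 <= dw - ds by rewrite subr_ge0.
case: t tK => [_|s]; rewrite /Mpt /Rpt /=.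
  have den : 0 < Kw%:R / (1 - dw) + Ks%:R / (1 - ds) by rewrite addr_gt0 ?divr_gt0.
  set X := F%:R * _; rewrite -[X]addr0.
  have X0 : 0 <= X by rewrite mulr_ge0 // invr_ge0 ltW.
  apply: (@feasible_two_level _ _ _ _ 0) => //.
  - by rewrite mulr0 !mul0r; apply: mulr_ge0 => //; exact: mulr_ge0.
  - have XE : X * (Kw%:R / (1 - dw) + Ks%:R / (1 - ds)) = F%:R by rewrite divfK ?gt_eqF.
    rewrite -[leRHS]XE le_eqVlt; apply/orP; left; apply/eqP; field.
    by rewrite !gt_eqF.
  - by rewrite mul0r mulr0 addr0 !mulr0.
rewrite ltnS leq_eqVlt => /orP[/eqP ->|sK].
  rewrite ltnn; set X := F%:R * (1 - ds) / Ks%:R; rewrite -[X]addr0 /X.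
  apply: (@feasible_two_level _ _ _ _ Kw) => //.
  - by rewrite divr_ge0 // mulr_ge0 // ltW.
  - by rewrite subrr !mulr0 !mul0r.
  - rewrite subrr le_eqVlt; apply/orP; left; apply/eqP; field.
    by rewrite !gt_eqF // ?addr_gt0 // ltW.
  - by rewrite mulr0 addr0; field; rewrite gt_eqF.
rewrite sK; set rh := rho Kw Ks dw ds s.+1.
have sKR : (0 : R) < Kw%:R - s%:R by rewrite subr_gt0 ltr_nat.
have sKR1 : (0 : R) <= Kw%:R - s.+1%:R by rewrite subr_ge0 ler_nat.
have s1 : (0 : R) < s.+1%:R by [].
have s2 : (0 : R) < s.+2%:R by [].
have e0 : 0 <= (dw - ds) / (1 - dw) by rewrite divr_ge0 // ltW.
have sE : Kw%:R - s.+1%:R + 1 = Kw%:R - s%:R :> R by rewrite -natr1; ring.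
have rhE : rh = 1 + (Kw%:R - s%:R) / (s.+1%:R * Ks%:R) * ((dw - ds) / (1 - dw)).
  by rewrite /rh /rho sE.
have rh1 : 1 <= rh by rewrite rhE lerDl mulr_ge0 // divr_ge0 ?mulr_ge0 // ltW.
rewrite sE natr1.
set den := _ / _ * (1 + _) + _.
have den0 : 0 < den.
  apply: ltr_wpDl; last by rewrite mulr_gt0 // divr_gt0.
  apply: mulr_ge0; first by apply: divr_ge0; exact: ltW.
  apply: addr_ge0 => //; apply: mulr_ge0 => //; exact: divr_ge0.
(* [Y] makes the piggybacking condition an equality, and [X] then exhausts the time budget. *)
pose X := F%:R * (1 - dw) / den; pose Y := X * (rh - 1).
have X0 : 0 <= X by apply: divr_ge0; [apply: mulr_ge0 => //|]; exact: ltW.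
have rh0 : rh != 0 by rewrite gt_eqF // (lt_le_trans ltr01).
have -> : F%:R * (1 - dw) * rh / den = X + Y by rewrite /Y /X; field; rewrite gt_eqF.
apply: (@feasible_two_level _ _ _ _ s) => //.
- exact: ltnW.
- by rewrite mulr_ge0 // subr_ge0.
- by move=> sKe; rewrite sKe ltnn in sK.
- rewrite /Y rhE le_eqVlt; apply/orP; left; apply/eqP; field.
  by rewrite nat1r !gt_eqF.
- have XE : X * den / (1 - dw) = F%:R by rewrite /X divfK ?gt_eqF // mulfK ?gt_eqF.
  rewrite -[leRHS]XE /Y rhE /den le_eqVlt; apply/orP; left; apply/eqP; field.
  by rewrite !gt_eqF //; lra.
- rewrite /Y; field; rewrite rh0 gt_eqF //.
Qed.

Lemma feasible_convex (N F Kw Ks D : nat) (dw ds : R) (al be : 'I_N -> nat -> R)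
    (r m lam : 'I_N -> R) :
  (forall t, feasible F Kw Ks D dw ds (al t) (be t) (r t) (m t)) ->
  (forall t, 0 <= lam t) -> \sum_t lam t = 1 ->
  feasible F Kw Ks D dw ds (fun a => \sum_t lam t * al t a)
    (fun a => \sum_t lam t * be t a) (\sum_t lam t * r t) (\sum_t lam t * m t).
Proof.
move=> H lam0 lam1.
have comb n (f : 'I_N -> nat -> R) (c : nat -> nat) :
    \sum_(a < n) (\sum_t lam t * f t a) *+ c a = \sum_t lam t * \sum_(a < n) f t a *+ c a.
  transitivity (\sum_(a < n) \sum_t lam t * (f t a *+ c a)).
    by apply: eq_bigr => a _; rewrite -sumrMnl; apply: eq_bigr => t _; rewrite mulrnAr.
  by rewrite exchange_big; apply: eq_bigr => t _; rewrite big_distrr.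
have addE a : \sum_t lam t * al t a + \sum_t lam t * be t a = \sum_t lam t * (al t a + be t a).
  by rewrite -big_split; apply: eq_bigr => t _; rewrite /= mulrDr.
split.
- by split=> a; apply: sumr_ge0 => t _; have [[? ?] _ _ _ _] := H t; rewrite mulr_ge0.
- by apply: big1 => t _; have [_ -> _ _ _] := H t; rewrite mulr0.
- move=> a aK; rewrite addE mulr_sumr !mulr_suml; apply: ler_sum => t _.
  have [_ _ /(_ a aK) h _ _] := H t.
  by move: (ler_wpM2l (lam0 t) h); congr (_ <= _); ring.
- under eq_bigr do rewrite addE.
  rewrite (comb _ (fun t a => al t a + be t a) (fun a => 'C(Kw, a.+1))) comb.
  rewrite mulr_sumr !mulr_suml -big_split /=.
  have -> : F%:R = \sum_t lam t * F%:R :> R by rewrite -mulr_suml lam1 mul1r.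
  apply: ler_sum => t _; have [_ _ _ h _] := H t.
  by move: (ler_wpM2l (lam0 t) h); congr (_ <= _); ring.
- split.
    under [RHS]eq_bigr do rewrite addE.
    rewrite (comb _ (fun t a => al t a + be t a)); apply: eq_bigr => t _.
    by have [_ _ _ _ [-> _]] := H t.
  transitivity (D%:R * \sum_(a < Kw.+1) (\sum_t lam t * (a%:R * (al t a + be t a))) *+ 'C(Kw, a)).
    congr (_ * _); apply: eq_bigr => a _; rewrite addE mulr_sumr; congr (_ *+ _).
    by apply: eq_bigr => t _; rewrite mulrCA.
  rewrite (comb _ (fun t a => a%:R * (al t a + be t a))) !mulr_sumr.
  by apply: eq_bigr => t _; have [_ _ _ _ [_ h]] := H t; rewrite mulrCA h mulrCA.
Qed.

(** At rate 0 there is a single message, so decoding cannot fail. This keeps the supremum away from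
    -oo and settles nonpositive target rates. *)
Lemma achievable0 (F Kw Ks D : nat) (dw ds m : R) : 0 <= m ->
  achievable F Kw Ks D dw ds 0 m.
Proof.
move=> m0; split=> //; split=> // eps eps0; exists 0%N => n _.
have L1 : nvals n (0 : R) = 1%N by rewrite /nvals mulr0 powRr0 truncn1.
pose c0 := Ordinal (nvals_gt0 n m0); pose w0 := Ordinal (nvals_gt0 n (lexx (0 : R))).
have all_w0 w : w = w0.
  by apply: val_inj => /=; case: w => w /=; rewrite L1 ltnS leqn0 => /eqP.
exists (Scheme (fun _ _ => c0) (fun _ _ => [ffun=> [ffun=> false]])
  (fun _ _ _ _ => w0) (fun _ _ _ => w0)) => d.
rewrite /error_prob big1 ?ltW // => W _; apply: big1 => e _.
rewrite (_ : some_error _ _ _ _ = false) ?mulr0 //.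
by apply/negbTE; rewrite negb_or; apply/andP; split; apply/existsPn => i /=;
  rewrite negbK (all_w0 (W _)).
Qed.

End CornerPoints.

(* C(M) lies above the upper convex hull of the points (R_t, M_t), t = 0..Kw+1:
   for every convex combination of the points, C(sum lam_t M_t) >= sum lam_t R_t. *)
Theorem theorem1 (R : realType) (F Kw Ks D : nat) (dw ds : R) :
  (0 < Kw)%N -> (0 < Ks)%N -> (Kw + Ks <= D)%N ->
  0 < ds -> ds <= dw -> dw < 1 ->
  forall lam : 'I_(Kw.+2) -> R,
    (forall t, 0 <= lam t) -> \sum_(t < Kw.+2) lam t = 1 ->
    ((\sum_(t < Kw.+2) lam t * Rpt F Kw Ks dw ds t)%:E
       <= capacity_memory F Kw Ks D dw ds
            (\sum_(t < Kw.+2) lam t * Mpt F Kw Ks D dw ds t))%E.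
Proof.
move=> Kw0 Ks0 _ ds0 dsw dw1 lam lam0 lam1.
set r := \sum_(t < _) lam t * Rpt _ _ _ _ _ _; set m := \sum_(t < _) _.
have [al [be feas]] : exists al be, feasible F Kw Ks D dw ds al be r m.
  have /choice[al /choice[be H]] : forall t : 'I_Kw.+2, exists al be,
      feasible F Kw Ks D dw ds al be (Rpt F Kw Ks dw ds t) (Mpt F Kw Ks D dw ds t).
    by move=> t; apply: feasible_point => //; rewrite -ltnS.
  by have := feasible_convex H lam0 lam1; do 2 eexists; eassumption.
have m0 : 0 <= m.
  have KR : (0 : R) < Kw%:R by rewrite ltr0n.
  have [[al0 be0] _ _ _ [_ mE]] := feas.
  rewrite -(pmulr_rge0 _ KR) -mE mulr_ge0 // sumr_ge0 // => a _.
  by rewrite mulrn_wge0 // mulr_ge0 // addr_ge0.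
have sup_ge r' : achievable F Kw Ks D dw ds r' m ->
    (r'%:E <= capacity_memory F Kw Ks D dw ds m)%E.
  by move=> h; apply: ereal_sup_ubound; exists r'.
have sup0 := sup_ge 0 (achievable0 F Kw Ks D dw ds m0).
have [r0|r0] := leP r 0; first by apply: le_trans sup0; rewrite lee_fin.
have F0 : (0 < F)%N.
  rewrite lt0n; apply: contraTneq r0 => F0; rewrite -leNgt /r big1 // => t _.
  by rewrite /Rpt F0; case: ifP => _; [|case: ifP => _]; rewrite !mul0r mulr0.
(* Only rates strictly below [r] are known to be achievable. A supremum [s] below [r] would be
   finite, and the achievable midpoint of [s] and [r] would exceed it. *)
rewrite leNgt; apply/negP => sup_r.
case E : (capacity_memory F Kw Ks D dw ds m) sup_r sup0 => [s| |] //; rewrite lte_fin lee_fin => sr s0.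
have : ((((s + r) / 2)%:E <= capacity_memory F Kw Ks D dw ds m)%E).
  by apply: sup_ge; apply: (feasible_achievable F0 Kw0 ds0 dsw dw1 feas); lra.
by rewrite E lee_fin; lra.
Qed.
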